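(* Consider the iterates of the noisy-data RIAT algorithm (described in the context) with $\mu_1>0$ and with parameters $\tau>1$, $\mu_0>0$ chosen such that $$\mathfrak C_0:=1-\frac1\tau-\frac{\mu_0}{4\nu}>0 .$$ Let $\hat u\in\tilde{\mathcal S}$, and put $\tilde\Gamma_{k,m}^\delta:=D_{\mathfrak f}^{\zeta_{k,m}^\delta}(\hat u,u_{k,m}^\delta)$ and $\tilde\Gamma_{k}^\delta:=D_{\mathfrak f}^{\zeta_{k}^\delta}(\hat u,u_{k}^\delta)$. Then for all integers $0\le k\le k_\delta$ and $m=0,\dots,m_k-1$, $$\tilde\Gamma_{k,m+1}^\delta-\tilde\Gamma_{k,m}^\delta\le-\mathfrak C_0\,\tilde t_{k,m}^\delta\|\tilde h_{k,m}^\delta\|^2\qquad\text{and}\qquad \tilde\Gamma_{k+1,0}^\delta-\tilde\Gamma_{k+1}^\delta\le-\mathfrak C_0\,\tilde t_{k+1}^\delta\,\tilde\Phi_{k+1}^\delta .$$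
   Context: A discretization level is fixed and suppressed in the notation. The finite-dimensional solution space is identified with $\mathbb R^{n}$ with the Euclidean inner product $\langle\cdot,\cdot\rangle$ and norm; $^*$ denotes transpose. Functional: $\mathfrak f:\mathbb R^{n}\to\mathbb R\cup\{+\infty\}$ is proper, lower semicontinuous and $\nu$-strongly convex with $\nu>0$, i.e. $\mathfrak f(\lambda u+(1-\lambda)\bar u)+\nu\lambda(1-\lambda)\|u-\bar u\|^2\le\lambda \mathfrak f(u)+(1-\lambda)\mathfrak f(\bar u)$ for all $u,\bar u\in\operatorname{dom}(\mathfrak f)$, $\lambda\in[0,1]$. For $\zeta\in\partial \mathfrak f(u)$ the Bregman distance is $D_{\mathfrak f}^{\zeta}(\bar u,u)=\mathfrak f(\bar u)-\mathfrak f(u)-\langle\zeta,\bar u-u\rangle$. Write $P(\zeta):=\arg\min_u\{\mathfrak f(u)-\langle\zeta,u\rangle\}$ (unique minimizer, so $\zeta\in\partial \mathfrak f(P(\zeta))$). Arnoldi projected systems: for $i=1,\dots,q$ let $\mathcal T_i\in\mathbb R^{n\times n}$, exact data $v_i\in\mathbb R^{n}$, and $1\le l<n$. The Arnoldi process for $\mathcal T_i$ (in the paper with starting vector $v_i^\delta$) gives $\mathcal T_i\tilde V_{l,i}=\tilde V_{l+1,i}H_i$, where $\tilde V_{l+1,i}\in\mathbb R^{n\times(l+1)}$ has orthonormal columns, $\tilde V_{l,i}$ consists of its first $l$ columns, and $H_i\in\mathbb R^{(l+1)\times l}$ is upper Hessenberg. Put $\tilde{\mathcal T}_i^l:=\tilde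 V_{l+1,i}H_i\tilde V_{l,i}^*$ and assume $\tilde{\mathcal S}:=\{u\in\operatorname{dom}(\mathfrak f):\tilde{\mathcal T}_i^lu=v_i,\ i=1,\dots,q\}\neq\emptyset$. Noisy data: $v_i^\delta\in\mathbb R^{n}$ with $\|v_i^\delta-v_i\|\le\delta_i$, $\delta=(\delta_1^2+\dots+\delta_q^2)^{1/2}$. Regularization parameters: $(\gamma_j)_{j\ge0}$ is a monotonically decreasing sequence of positive reals with $\sum_j1/\gamma_j=\infty$. In the algorithm, $\gamma_{k,m}:=\gamma_{\mathfrak z_{k,m}}$ and (for outer updates) $\gamma_k:=\gamma_{\mathfrak z_k}$, where $\mathfrak z_{k,m}$, $\mathfrak z_k$ are the total numbers of (inner and outer) updates performed up to the inner step $(k,m)$, respectively the outer step $k$: $\mathfrak z_{k,m}=\sum_{j<k}m_j+k+m$ and $\mathfrak z_k=\sum_{j<k}m_j+k-1$ for $k\ge1$. Below, a symbol $\gamma_k$ attached to an outer step is understood in this sense. Noisy-data RIAT algorithm. Input: $\tau>1,\mu_0>0,\mu_1>0$, $\zeta_0\in\mathbb R^{n}$, positive integers $m_0,m_1,\dots$. Set $\zeta_{0,0}^\delta=\zeta_0^\delta=\zeta_0$, $u_{0,0}^\delta=u_0^\delta=P(\zeta_0)$. For $k=0,1,2,\dots$: (inner loop) for $m=0,\dots,m_k-1$: draw $i=i_{k,m}\in\{1,\dots,q\}$ uniformly at random (independently); with $\tilde A=\gamma_{k,m}I+H_iH_i^*$ set $\tilde h_{k,m}^\delta=\tilde A^{-1/2}\tilde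 V_{l+1,i}^*(\tilde{\mathcal T}_i^lu_{k,m}^\delta-v_i^\delta)$, $\tilde g_{k,m}^\delta=\tilde V_{l,i}H_i^*\tilde A^{-1/2}\tilde h_{k,m}^\delta$; $\tilde t_{k,m}^\delta=\min\{\mu_0\|\tilde h_{k,m}^\delta\|^2/\|\tilde g_{k,m}^\delta\|^2,\mu_1\}$ if $\gamma_{k,m}\|\tilde h_{k,m}^\delta\|^2>\tau^2\delta_i^2$ and $\tilde t_{k,m}^\delta=0$ otherwise; $\zeta_{k,m+1}^\delta=\zeta_{k,m}^\delta-\tilde t_{k,m}^\delta\tilde g_{k,m}^\delta$, $u_{k,m+1}^\delta=P(\zeta_{k,m+1}^\delta)$. (outer step) $\zeta_{k+1}^\delta=\zeta_{k,m_k}^\delta$, $u_{k+1}^\delta=u_{k,m_k}^\delta$. With $K=k+1$, $\tilde A_{K,i}=\gamma_KI+H_iH_i^*$, $\tilde h_{K,i}^\delta=\tilde A_{K,i}^{-1/2}\tilde V_{l+1,i}^*(\tilde{\mathcal T}_i^lu_K^\delta-v_i^\delta)$: if $\gamma_K\|\tilde h_{K,i}^\delta\|^2\le\tau^2\delta_i^2$ for all $i$, the algorithm stops with output $u_K^\delta$. Put $\tilde\Delta_K^\delta=\{i:\gamma_K\|\tilde h_{K,i}^\delta\|^2>\tau^2\delta_i^2\}$, $\tilde g_K^\delta=\sum_{i\in\tilde\Delta_K^\delta}\tilde V_{l,i}H_i^*\tilde A_{K,i}^{-1/2}\tilde h_{K,i}^\delta$, $\tilde\Phi_K^\delta=\sum_{i\in\tilde\Delta_K^\delta}\|\tilde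 h_{K,i}^\delta\|^2$; $\tilde t_K^\delta=\min\{\mu_0\tilde\Phi_K^\delta/\|\tilde g_K^\delta\|^2,\mu_1\}$ if $\tilde\Delta_K^\delta\neq\emptyset$, $\tilde t_K^\delta=0$ otherwise; $\zeta_{K,0}^\delta=\zeta_K^\delta-\tilde t_K^\delta\tilde g_K^\delta$, $u_{K,0}^\delta=P(\zeta_{K,0}^\delta)$. A quotient with $\tilde g=0$ in the denominator is read as $+\infty$ (step size $\mu_1$). The stopping index $k_\delta$ is the smallest $k\ge1$ with $\gamma_k\|\tilde h_{k,i}^\delta\|^2\le\tau^2\delta_i^2$ for all $i$ ($k_\delta=\infty$ if there is none). The recursion is understood as formally continued past $k_\delta$, so all iterates are defined. *)

(* Defs.v *)
From HB Require Import structures.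
From mathcomp Require Import all_boot all_order all_algebra.
From mathcomp Require Import all_classical all_reals all_analysis.

Set Implicit Arguments.
Unset Strict Implicit.
Unset Printing Implicit Defensive.

Import Order.TTheory GRing.Theory Num.Theory.
Import numFieldNormedType.Exports.

Local Open Scope classical_set_scope.
Local Open Scope ring_scope.

Section EuclideanSpace.
Context {R : realType}.

Definition edot n (x y : 'cV[R]_n) : R := \sum_(i < n) x i 0 * y i 0.

(* The norm [`|x|] of the library on matrices is the max norm. *)
Definition enorm n (x : 'cV[R]_n) : R := Num.sqrt (edot x x).

Definition spd n (A : 'M[R]_n) : Prop :=
  A^T = A /\ forall x : 'cV[R]_n, x != 0 -> 0 < edot x (A *m x).

(* A^{-1/2}: for A symmetric positive definite, the set below has exactly one
   element, the principal square root of A^{-1}. *)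
Definition invsqrtmx n (A : 'M[R]_n) : 'M[R]_n :=
  xget 0 [set B : 'M[R]_n | spd B /\ B *m B = invmx A].

End EuclideanSpace.

(* A functional f : R^n -> R \cup {+oo} is encoded as an extended-real valued
   function that never takes the value -oo. *)
Section ConvexFunctionals.
Context {R : realType} {n : nat}.
Implicit Types (f : 'cV[R]_n -> \bar R) (u zeta : 'cV[R]_n).

Definition edom f : set 'cV[R]_n := [set u | (f u < +oo)%E].

Definition proper_functional f : Prop := (forall u, f u != -oo%E) /\ edom f !=set0.

Definition strongly_convex (nu : R) f : Prop :=
  forall u ubar (lambda : R), edom f u -> edom f ubar -> 0 <= lambda <= 1 ->
  (f (lambda *: u + (1 - lambda) *: ubar)%R
     + (nu * lambda * (1 - lambda) * enorm (u - ubar) ^+ 2)%:E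
   <= lambda%:E * f u + (1 - lambda)%:E * f ubar)%E.

Definition argmin (F : 'cV[R]_n -> \bar R) : set 'cV[R]_n :=
  [set u | forall w, (F u <= F w)%E].

(* P(zeta); the argmin set is a singleton when f is proper, lower
   semicontinuous and strongly convex. *)
Definition Pmin f zeta : 'cV[R]_n :=
  xget 0 (argmin (fun u => f u - (edot zeta u)%:E)%E).

Definition bregman f zeta ubar u : \bar R :=
  (f ubar - f u - (edot zeta (ubar - u))%:E)%E.

End ConvexFunctionals.

Section Arnoldi.
Context {R : realType} {n l : nat}.
Implicit Types (T : 'M[R]_n) (V : 'M[R]_(n, l.+1)) (H : 'M[R]_(l.+1, l)).

Definition first_cols V : 'M[R]_(n, l) := colsub (widen_ord (leqnSn l)) V.

Definition upper_hessenberg H : Prop :=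
  forall (r : 'I_l.+1) (c : 'I_l), (c.+1 < r)%N -> H r c = 0.

Definition arnoldi_decomposition T V H : Prop :=
  [/\ V^T *m V = 1%:M, upper_hessenberg H & T *m first_cols V = V *m H].

Definition arnoldi_approx V H : 'M[R]_n := V *m H *m (first_cols V)^T.

End Arnoldi.

Definition solution_set (R : realType) (n l q : nat) (f : 'cV[R]_n -> \bar R)
    (V : 'I_q -> 'M[R]_(n, l.+1)) (H : 'I_q -> 'M[R]_(l.+1, l))
    (v : 'I_q -> 'cV[R]_n) : set 'cV[R]_n :=
  [set u | edom f u /\ forall i, arnoldi_approx (V i) (H i) *m u = v i].

(* The random variables X a, a \in S, with values in 'I_q (carrying the
   discrete sigma-algebra), are independent and uniformly distributed. *)
Definition iid_uniform (d : measure_display) (Omega : measurableType d)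
    (R : realType) (Pr : probability Omega R) (I : choiceType) (q : nat)
    (S : set I) (X : I -> Omega -> 'I_q) : Prop :=
  [/\ forall a, S a -> forall B : set 'I_q, measurable (X a @^-1` B),
      forall a, S a -> forall i, Pr (X a @^-1` [set i]) = (q%:R^-1)%:E
    & forall (s : seq I) (B : I -> set 'I_q), uniq s -> {in s, forall a, S a} ->
      Pr (\bigcap_(a in [set` s]) (X a @^-1` B a))
      = (\prod_(a <- s) Pr (X a @^-1` B a))%E].

Record riat_input (R : realType) (n l q : nat) := RiatInput {
  rf : 'cV[R]_n -> \bar R;
  rV : 'I_q -> 'M[R]_(n, l.+1);
  rH : 'I_q -> 'M[R]_(l.+1, l);
  rv : 'I_q -> 'cV[R]_n;       (* noisy data *)
  rdelta : 'I_q -> R;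
  rgamma : nat -> R;
  rlen : nat -> nat;           (* lengths m_k of the inner loops *)
  rtau : R;
  rmu0 : R;
  rmu1 : R;
  rzeta0 : 'cV[R]_n
}.

Section RIAT.
Context {R : realType} {n l q : nat}.
Variables (D : riat_input R n l q) (idx : nat -> nat -> 'I_q).

Definition count_inner (k m : nat) : nat := (\sum_(j < k) rlen D j + k + m)%N.
Definition count_outer (k : nat) : nat := (\sum_(j < k) rlen D j + k - 1)%N.
Definition gamma_inner k m : R := rgamma D (count_inner k m).
Definition gamma_outer k : R := rgamma D (count_outer k).

Definition Ainvsqrt (gam : R) (i : 'I_q) : 'M[R]_l.+1 :=
  invsqrtmx (gam%:M + rH D i *m (rH D i)^T).

Definition hvec (gam : R) (i : 'I_q) (u : 'cV[R]_n) : 'cV[R]_l.+1 :=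
  Ainvsqrt gam i *m (rV D i)^T
    *m (arnoldi_approx (rV D i) (rH D i) *m u - rv D i).

Definition gvec (gam : R) (i : 'I_q) (u : 'cV[R]_n) : 'cV[R]_n :=
  first_cols (rV D i) *m (rH D i)^T *m Ainvsqrt gam i *m hvec gam i u.

Definition active (gam : R) (i : 'I_q) (u : 'cV[R]_n) : bool :=
  rtau D ^+ 2 * rdelta D i ^+ 2 < gam * enorm (hvec gam i u) ^+ 2.

(* min {mu0 * phi / ||g||^2, mu1}, the quotient being +oo for g = 0 *)
Definition step_size (phi : R) (g : 'cV[R]_n) : R :=
  if g == 0 then rmu1 D
  else Num.min (rmu0 D * phi / enorm g ^+ 2) (rmu1 D).

Definition inner_step_size (gam : R) (i : 'I_q) (u : 'cV[R]_n) : R :=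
  if active gam i u
  then step_size (enorm (hvec gam i u) ^+ 2) (gvec gam i u) else 0.

Definition outer_active (gam : R) (u : 'cV[R]_n) : {set 'I_q} :=
  [set i | active gam i u]%SET.
Definition outer_g (gam : R) (u : 'cV[R]_n) : 'cV[R]_n :=
  \sum_(i in outer_active gam u) gvec gam i u.
Definition outer_Phi (gam : R) (u : 'cV[R]_n) : R :=
  \sum_(i in outer_active gam u) enorm (hvec gam i u) ^+ 2.
Definition outer_step_size (gam : R) (u : 'cV[R]_n) : R :=
  if outer_active gam u != finset.set0
  then step_size (outer_Phi gam u) (outer_g gam u) else 0.

(* The primal iterate attached to a dual iterate zeta is always P(zeta), so the
   recursion runs on the dual iterates only. *)
Fixpoint inner_loop (k : nat) (zeta : 'cV[R]_n) (m : nat) : 'cV[R]_n :=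
  if m is m'.+1 then
    let z := inner_loop k zeta m' in
    let u := Pmin (rf D) z in
    let gam := gamma_inner k m' in
    let i := idx k m' in
    z - inner_step_size gam i u *: gvec gam i u
  else zeta.

Definition outer_update (K : nat) (zeta : 'cV[R]_n) : 'cV[R]_n :=
  let u := Pmin (rf D) zeta in
  zeta - outer_step_size (gamma_outer K) u *: outer_g (gamma_outer K) u.

(* zeta_{k,0} *)
Fixpoint zeta_start (k : nat) : 'cV[R]_n :=
  if k is k'.+1 then
    outer_update k (inner_loop k' (zeta_start k') (rlen D k'))
  else rzeta0 D.

(* zeta_{k,m} and u_{k,m} *)
Definition zeta_in (k m : nat) : 'cV[R]_n := inner_loop k (zeta_start k) m.
Definition u_in (k m : nat) : 'cV[R]_n := Pmin (rf D) (zeta_in k m).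

(* zeta_k and u_k *)
Definition zeta_out (k : nat) : 'cV[R]_n :=
  if k is k'.+1 then zeta_in k' (rlen D k') else rzeta0 D.
Definition u_out (k : nat) : 'cV[R]_n := Pmin (rf D) (zeta_out k).

Definition h_in (k m : nat) : 'cV[R]_l.+1 :=
  hvec (gamma_inner k m) (idx k m) (u_in k m).
Definition t_in (k m : nat) : R :=
  inner_step_size (gamma_inner k m) (idx k m) (u_in k m).
Definition Phi_out (k : nat) : R := outer_Phi (gamma_outer k) (u_out k).
Definition t_out (k : nat) : R := outer_step_size (gamma_outer k) (u_out k).

Definition stops (k : nat) : bool :=
  (0 < k)%N &&
  [forall i, gamma_outer k * enorm (hvec (gamma_outer k) i (u_out k)) ^+ 2
             <= rtau D ^+ 2 * rdelta D i ^+ 2].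

(* k_delta, with None standing for infinity *)
Definition stopping_index : option nat :=
  if pselect (exists k, stops k) is left ex_stop then Some (ex_minn ex_stop)
  else None.

(* k <= k_delta *)
Definition upto_stop (k : nat) : Prop :=
  if stopping_index is Some kd then (k <= kd)%N else True.

Definition Gamma_in (uhat : 'cV[R]_n) (k m : nat) : \bar R :=
  bregman (rf D) (zeta_in k m) uhat (u_in k m).
Definition Gamma_out (uhat : 'cV[R]_n) (k : nat) : \bar R :=
  bregman (rf D) (zeta_out k) uhat (u_out k).

End RIAT.

(* Main.v *)
(* One dual step zeta' = zeta - t g changes the Bregman distance to uhat by
     - D^zeta(u', u) - t <g, u' - u> + t <g, uhat - u>,
   where u, u' are the primal iterates attached to zeta, zeta'. By nu-strong
   convexity, D^zeta(u', u) >= nu ||u' - u||^2, which with Young's inequality bounds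
   the first two terms by t^2 ||g||^2 / (4 nu) <= t mu0 Phi / (4 nu). Since
   V^* T^l = H V_l^*, the adjoint identity gives <g, uhat - u> = - ||h||^2 up to
   a noise term of size ||h|| delta / sqrt gamma, which the discrepancy test
   gamma ||h||^2 > tau^2 delta^2 bounds by ||h||^2 / tau. *)
Require Import Defs.
From HB Require Import structures.
From mathcomp Require Import all_boot all_order all_algebra.
From mathcomp Require Import all_classical all_reals all_analysis.
From mathcomp Require Import finmap ring lra.

Set Implicit Arguments.
Unset Strict Implicit.
Unset Printing Implicit Defensive.

Import Order.TTheory GRing.Theory Num.Theory.
Import numFieldNormedType.Exports.

Local Open Scope classical_set_scope.
Local Open Scope ring_scope.

(** * Euclidean inner product: Bessel, Young, invertibility *)

Section EuclideanGeometry.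
Context {R : realType}.

Lemma edotC n (x y : 'cV[R]_n) : edot x y = edot y x.
Proof. by apply: eq_bigr => i _; rewrite mulrC. Qed.

Lemma edotDl n (x y z : 'cV[R]_n) : edot (x + y) z = edot x z + edot y z.
Proof.
by rewrite /edot -big_split; apply: eq_bigr => i _; rewrite mxE mulrDl.
Qed.

Lemma edotZl n a (x y : 'cV[R]_n) : edot (a *: x) y = a * edot x y.
Proof. by rewrite /edot mulr_sumr; apply: eq_bigr => i _; rewrite mxE mulrA. Qed.

Lemma edotNl n (x y : 'cV[R]_n) : edot (- x) y = - edot x y.
Proof. by rewrite -scaleN1r edotZl mulN1r. Qed.

Lemma edotBl n (x y z : 'cV[R]_n) : edot (x - y) z = edot x z - edot y z.
Proof. by rewrite edotDl edotNl. Qed.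

Lemma edotDr n (x y z : 'cV[R]_n) : edot x (y + z) = edot x y + edot x z.
Proof. by rewrite !(edotC x) edotDl. Qed.

Lemma edotZr n a (x y : 'cV[R]_n) : edot x (a *: y) = a * edot x y.
Proof. by rewrite !(edotC x) edotZl. Qed.

Lemma edotBr n (x y z : 'cV[R]_n) : edot x (y - z) = edot x y - edot x z.
Proof. by rewrite !(edotC x) edotBl. Qed.

Lemma edotNr n (x y : 'cV[R]_n) : edot x (- y) = - edot x y.
Proof. by rewrite !(edotC x) edotNl. Qed.

Lemma edot0l n (x : 'cV[R]_n) : edot 0 x = 0.
Proof. by rewrite -(scale0r 0) edotZl mul0r. Qed.

Lemma edot_suml n (I : finType) (P : pred I) (F : I -> 'cV[R]_n) y :
  edot (\sum_(i | P i) F i) y = \sum_(i | P i) edot (F i) y.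
Proof.
by elim/big_rec2: _ => [|i x s _ <-]; rewrite ?edot0l ?edotDl.
Qed.

Lemma edot_mulmxl m n (A : 'M[R]_(m, n)) x y :
  edot (A *m x) y = edot x (A^T *m y).
Proof.
have edotE k (a b : 'cV[R]_k) : edot a b = (a^T *m b) 0 0.
  by rewrite mxE; apply: eq_bigr => i _; rewrite mxE.
by rewrite !edotE trmx_mul mulmxA.
Qed.

Lemma edot_ge0 n (x : 'cV[R]_n) : 0 <= edot x x.
Proof. by apply: sumr_ge0 => i _; rewrite -expr2 sqr_ge0. Qed.

Lemma sqr_coord_le_edot n (x : 'cV[R]_n) i : x i 0 ^+ 2 <= edot x x.
Proof.
rewrite /edot (bigD1 i) //= -expr2 lerDl.
by apply: sumr_ge0 => j _; rewrite -expr2 sqr_ge0.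
Qed.

Lemma edot_gt0 n (x : 'cV[R]_n) : (0 < edot x x) = (x != 0).
Proof.
apply/idP/idP => [|x0]; first by apply: contraTneq => ->; rewrite edot0l ltxx.
rewrite lt_neqAle edot_ge0 andbT eq_sym; apply: contra x0 => /eqP xx0.
apply/eqP/matrixP => i j; rewrite ord1 mxE; apply/eqP.
by rewrite -sqrf_eq0 eq_le sqr_ge0 andbT -xx0 sqr_coord_le_edot.
Qed.

Lemma enorm_ge0 n (x : 'cV[R]_n) : 0 <= enorm x.
Proof. exact: sqrtr_ge0. Qed.

Lemma sqr_enorm n (x : 'cV[R]_n) : enorm x ^+ 2 = edot x x.
Proof. by rewrite sqr_sqrtr ?edot_ge0. Qed.

Lemma coord_le_enorm n (x : 'cV[R]_n) i : `|x i 0| <= enorm x.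
Proof.
by rewrite -sqrtr_sqr ler_sqrt ?edot_ge0 // sqr_coord_le_edot.
Qed.

(* Positivity of [||x - V V^T x||^2]. *)
Lemma bessel n m (V : 'M[R]_(n, m)) x :
  V^T *m V = 1%:M -> edot (V^T *m x) (V^T *m x) <= edot x x.
Proof.
move=> VV; have := edot_ge0 (x - V *m (V^T *m x)).
rewrite edotBl !edotBr (edotC x) !edot_mulmxl.
by rewrite [in V^T *m (V *m _)]mulmxA VV mul1mx; lra.
Qed.

(** Expand [||2 a x - y||^2 >= 0] and divide by [4 a]. *)
Lemma edot_le_young n (a : R) (x y : 'cV[R]_n) : 0 < a ->
  edot x y <= a * edot x x + edot y y / (4 * a).
Proof.
move=> a0; have := edot_ge0 ((2 * a) *: x - y).
rewrite edotBl !edotBr !edotZl !edotZr (edotC y) => h.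
rewrite -subr_ge0.
have -> : a * edot x x + edot y y / (4 * a) - edot x y =
  (2 * a * (2 * a * edot x x) - 2 * a * edot x y -
   (2 * a * edot x y - edot y y)) / (4 * a) by field; lra.
by rewrite divr_ge0 //; lra.
Qed.

Lemma spd_unitmx n (A : 'M[R]_n) : spd A -> A \in unitmx.
Proof.
move=> [At A0]; rewrite -row_free_unit; apply: inj_row_free => w wA.
apply/eqP; apply: contraT; rewrite -trmx_eq0 => /A0.
by rewrite -At -trmx_mul wA trmx0 edotC edot0l ltxx.
Qed.

End EuclideanGeometry.

(** * Existence of minimizers and quadratic growth around them *)

Section Minimizers.
Context {R : realType} {n : nat}.
Implicit Types (f : 'cV[R]_n -> \bar R) (u zeta : 'cV[R]_n).

(** Without a minimizer, the open sets [{r < F}], [r] a finite value of [F] on [K], cover [K]. The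
    least [r] of a finite subcover is itself a value [F w], and no set of the subcover contains
    [w]. *)
Lemma lower_semicontinuous_compact_min (X : ptopologicalType)
    (F : X -> \bar R) (K : set X) (x0 : X) :
  lower_semicontinuous F -> compact K -> K x0 ->
  (forall x, F x != -oo%E) -> (F x0 < +oo)%E ->
  exists2 x, K x & forall w, K w -> (F x <= F w)%E.
Proof.
move=> lscF cK Kx0 FNy Fx0.
pose S := [set r : R | exists2 w, K w & F w = r%:E].
apply: contrapT => nomin.
have lower w : K w -> exists2 r, S r & (r%:E < F w)%E.
  move=> Kw; apply: contrapT => nolower; apply: nomin.
  have lbw r : S r -> (F w <= r%:E)%E.
    by move=> Sr; rewrite leNgt; apply/negP => rw; apply: nolower; exists r.
  exists w => // z Kz; case Fz : (F z) (FNy z) => [r| |] // _.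
    by apply: lbw; exists z.
  by rewrite leey.
move: cK; rewrite compact_cover.
move=> /(_ _ S (fun r => [set x | (r%:E < F x)%E]))[r _||s sS cov].
- by move/lower_semicontinuousP : lscF; exact.
- by move=> w /lower[r Sr rw]; exists r.
(* Covering [x0] shows that the subcover is nonempty; [r0] seeds the minimum. *)
have [r0 /= r0s _] := cov _ Kx0.
pose r := \big[Num.min/r0]_(a <- finmap.enum_fset s) a.
have rs : r \in s.
  by rewrite /r big_seq; elim/big_ind: _ => // a b sa sb; case: ltP.
have /= [w Kw Fw] := set_mem (sS _ rs).
have [a /= sa] := cov _ Kw.
by rewrite Fw lte_fin ltNge ge_bigmin_seq.
Qed.

Lemma edot_continuous zeta : continuous (edot zeta).
Proof.
rewrite /edot; apply: continuous_big => [|i _].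
  exact: add_continuous.
by move=> y; exact: (cvgM (cvg_cst _) (@coord_continuous R _ _ i 0 y)).
Qed.

(** Choose [b] between [a + <zeta, x>] and [f x]: near [x], both [b < f] and [<zeta, .> < b - a]
    hold. *)
Lemma lower_semicontinuous_tilt f zeta : lower_semicontinuous f ->
  lower_semicontinuous (fun u => f u - (edot zeta u)%:E)%E.
Proof.
move=> lscf x a /=; rewrite EFinN lteBrDr// -EFinD => axf.
have [b axb bfx] : exists2 b, a + edot zeta x < b & (b%:E < f x)%E.
  case: (f x) axf => [r| |] //; last by exists (a + edot zeta x + 1); rewrite ?ltry ?ltrDl.
  rewrite lte_fin => ar; exists ((a + edot zeta x + r) / 2); rewrite ?lte_fin; lra.
have [W Wx bW] := lscf _ _ bfx.
exists (W `&` [set y | edot zeta y < b - a]).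
  apply: filterI => //; apply: (@edot_continuous zeta x [set y | y < b - a]).
  by apply: open_nbhs_nbhs; split; [exact: open_lt|rewrite /= ltrBrDl].
move=> y [/bW by_ /= yb]; rewrite /= EFinN lteBrDr// -EFinD (le_lt_trans _ by_)//.
by rewrite lee_fin -lerBrDl ltW.
Qed.

Lemma edom_fin_num f u : (forall w, f w != -oo%E) -> edom f u ->
  f u = (fine (f u))%:E.
Proof. by move=> fNy fu; rewrite fineK // fin_numE fNy lt_eqF. Qed.

Lemma edom_tilt f zeta :
  edom (fun u => f u - (edot zeta u)%:E)%E = edom f.
Proof.
by apply/seteqP; split=> u; rewrite /edom/=; case: (f u) => [r| |]; rewrite ?ltry.
Qed.

Lemma proper_functional_tilt f zeta : proper_functional f ->
  proper_functional (fun u => f u - (edot zeta u)%:E)%E.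
Proof.
move=> [fNy dom]; split; last by rewrite edom_tilt.
by move=> u; case: (f u) (fNy u).
Qed.

Lemma strongly_convex_tilt nu f zeta :
  proper_functional f -> strongly_convex nu f ->
  strongly_convex nu (fun u => f u - (edot zeta u)%:E)%E.
Proof.
move=> [fNy _] scf u w t; rewrite edom_tilt => fu fw t01.
have := scf u w t fu fw t01.
rewrite (edom_fin_num fNy fu) (edom_fin_num fNy fw) edotDr !edotZr.
rewrite -!EFinB -!EFinM -!EFinD; case: (f _) (fNy (t *: u + (1 - t) *: w)) => // r _.
by rewrite -!EFinD !lee_fin; lra.
Qed.

Lemma cube_compact (x0 : 'cV[R]_n) r :
  compact [set y : 'rV[R]_n | forall i, `|y 0 i - x0 i 0| <= r].
Proof.
have := @rV_compact R n (fun i => `[x0 i 0 - r, x0 i 0 + r]%classic).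
move=> /(_ (fun i => @segment_compact _ _ _)).
by congr compact; apply/seteqP; split => y /= yK i; have := yK i;
  rewrite in_itv /= ler_distl.
Qed.

Lemma trmx_continuous : continuous (fun y : 'rV[R]_n => y^T : 'cV[R]_n).
Proof.
move=> /= y s /= /(nbhs_ballP y^T)[e e0 es].
apply/nbhs_ballP; exists e => //= z [_ yz]; apply: es; split => // i j.
by rewrite !mxE; exact: yz.
Qed.

(** The minimum is taken over the compact cube of half-width [r], which contains the Euclidean ball;
    the minimizer itself may lie outside the ball. *)
Lemma cube_min f (x0 : 'cV[R]_n) r :
  lower_semicontinuous f -> (forall w, f w != -oo%E) -> edom f x0 -> 0 <= r ->
  exists2 x, (f x <= f x0)%E & forall w, enorm (w - x0) <= r -> (f x <= f w)%E.
Proof.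
move=> lscf fNy fx0 r0.
pose K := [set y : 'rV[R]_n | forall i, `|y 0 i - x0 i 0| <= r].
have Kx0 : K x0^T by move=> i; rewrite mxE subrr normr0.
have [|||x Kx xmin] := @lower_semicontinuous_compact_min _ (fun y => f y^T) K _ _
  (@cube_compact x0 r) Kx0.
- move=> y a /lscf[W Wy Wa]; exists ((fun y => y^T) @^-1` W).
    exact: trmx_continuous.
  by move=> z; exact: Wa.
- by move=> y; exact: fNy.
- by rewrite trmxK.
exists x^T => [|w wr]; first by have := xmin _ Kx0; rewrite trmxK.
rewrite -(trmxK w); apply: xmin => i; rewrite mxE.
by apply: le_trans wr; have := coord_le_enorm (w - x0) i; rewrite !mxE.
Qed.

(* If c is the minimum of f over a neighbourhood of the unit ball around x0,
   comparing f at the point of the segment [x0, u] at distance 1 from x0 gives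
   f u >= f x0 + s (c - f x0) + nu s (s - 1) with s = ||u - x0||. *)
Lemma strongly_convex_coercive nu f (x0 : 'cV[R]_n) :
  0 < nu -> lower_semicontinuous f -> proper_functional f ->
  strongly_convex nu f -> edom f x0 ->
  exists2 r, 0 <= r & forall u, r < enorm (u - x0) -> (f x0 <= f u)%E.
Proof.
move=> nu0 lscf [fNy _] scf fx0.
have [x fxx0 xmin] := cube_min lscf fNy fx0 ler01.
have fx : edom f x by apply: le_lt_trans fx0.
set c := fine (f x); set b := fine (f x0).
have cb : c <= b by rewrite -lee_fin -!edom_fin_num.
(* Beyond this radius [b - c <= nu (s - 1)], so the lower bound [b + s (nu (s - 1) - (b - c))] for
   [f u] is at least [b]. *)
exists (1 + (b - c) / nu) => [|u]; first by rewrite addr_ge0// divr_ge0// ?subr_ge0// ltW.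
set s := enorm _ => rs.
have s1 : 1 < s by apply: le_lt_trans rs; rewrite lerDl divr_ge0// ?subr_ge0// ltW.
have s0 : 0 < s by lra.
case fuE : (f u) (fNy u) => [a| |] // _; last by rewrite leey.
have fu : edom f u by rewrite /edom /= fuE ltry.
have := scf u x0 s^-1 fu fx0; rewrite invr_ge0 ltW//= invf_le1// (ltW s1).
move=> /(_ isT); rewrite -/s (edom_fin_num fNy fx0) -/b fuE.
set w := _ *: _ + _ => hw.
have cw : (c%:E <= f w)%E.
  rewrite -edom_fin_num //; apply: xmin.
  have -> : w - x0 = s^-1 *: (u - x0).
    by rewrite /w; apply/matrixP => i j; rewrite !mxE; ring.
  rewrite /enorm edotZl edotZr mulrA -expr2 -sqr_enorm -exprMn mulVf ?gt_eqF//.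
  by rewrite expr1n sqrtr1.
have {hw} : (c%:E + (nu * s^-1 * (1 - s^-1) * s ^+ 2)%:E <=
    s^-1%:E * a%:E + (1 - s^-1)%:E * b%:E)%E.
  by apply: le_trans hw; rewrite leeD2r.
rewrite -!EFinM -!EFinD !lee_fin => h.
have {}h : c * s + nu * (s - 1) * s <= a + (s - 1) * b.
  have := ler_wpM2l (ltW s0) h.
  have -> : s * (c + nu / s * (1 - s^-1) * s ^+ 2) = c * s + nu * (s - 1) * s by field; lra.
  by have -> : s * (s^-1 * a + (1 - s^-1) * b) = a + (s - 1) * b by field; lra.
have : b - c <= nu * (s - 1).
  by rewrite mulrC -ler_pdivrMr//; lra.
nra.
Qed.

(** Coercivity handles points outside a ball around [x0]; inside, the minimizer over a surrounding
    cube is at least as good. *)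
Lemma strongly_convex_argmin nu f :
  0 < nu -> lower_semicontinuous f -> proper_functional f ->
  strongly_convex nu f -> argmin f !=set0.
Proof.
move=> nu0 lscf properf scf; have [fNy [x0 fx0]] := properf.
have [r r0 far] := strongly_convex_coercive nu0 lscf properf scf fx0.
have [x fxx0 xmin] := cube_min lscf fNy fx0 r0.
exists x => u; have [/xmin//|/far] := leP (enorm (u - x0)) r.
exact: le_trans.
Qed.

Lemma argmin_edom f u : proper_functional f -> argmin f u -> edom f u.
Proof. by move=> [_ [x fx]] /(_ x) ufx; exact: le_lt_trans fx. Qed.

(* The convexity inequality on the segment [u, w], divided by its parameter t,
   gives f w >= f u + nu (1 - t) ||w - u||^2; then t tends to 0. *)
Lemma strongly_convex_growth nu f u w :
  0 < nu -> proper_functional f -> strongly_convex nu f ->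
  argmin f u -> edom f w ->
  fine (f u) + nu * edot (w - u) (w - u) <= fine (f w).
Proof.
move=> nu0 properf scf umin fw; have [fNy _] := properf.
have fu := argmin_edom properf umin.
set N := edot _ _; have N0 : 0 <= N by exact: edot_ge0.
rewrite -lerBrDl; apply/ler_addgt0Pr => e e0.
set a := fine (f u); set b := fine (f w).
have step t : 0 < t -> t <= 1 -> nu * (1 - t) * N <= b - a.
  move=> t0 t1; have := scf w u t fw fu; rewrite ltW//= t1 => /(_ isT).
  rewrite sqr_enorm -/N (edom_fin_num fNy fu) (edom_fin_num fNy fw) -/a -/b.
  move=> h.
  have {h} : (a%:E + (nu * t * (1 - t) * N)%:E <= t%:E * b%:E + (1 - t)%:E * a%:E)%E.
    by apply: le_trans h; rewrite leeD2r// -edom_fin_num.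
  rewrite -!EFinM -!EFinD lee_fin => h.
  by rewrite -(ler_pM2l t0); lra.
have nN0 : 0 <= nu * N by rewrite mulr_ge0// ltW.
have M0 : 0 < nu * N + e by lra.
(* With this [t] the loss [nu t N] is at most [e]; the summand [e] keeps the denominator positive
   when [N = 0]. *)
have := step (e / (nu * N + e)).
rewrite divr_gt0// ler_pdivrMr// mul1r lerDr nN0 => /(_ isT isT).
have : nu * N - e <= nu * (1 - e / (nu * N + e)) * N.
  have -> : nu * (1 - e / (nu * N + e)) * N =
    nu * N - e * (nu * N / (nu * N + e)) by field; lra.
  by rewrite lerD2l lerN2 ler_piMr ?(ltW e0)// ler_pdivrMr// mul1r lerDl ltW.
by lra.
Qed.

(** The tilted functional inherits all hypotheses, so its argmin is nonempty and [xget] returns a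
    member of it instead of the default [0]. *)
Lemma PminP nu f zeta :
  0 < nu -> lower_semicontinuous f -> proper_functional f ->
  strongly_convex nu f ->
  argmin (fun u => f u - (edot zeta u)%:E)%E (Pmin f zeta).
Proof.
move=> nu0 lscf properf scf.
have [|||x] := @strongly_convex_argmin nu (fun u => f u - (edot zeta u)%:E)%E nu0.
- exact: lower_semicontinuous_tilt.
- exact: proper_functional_tilt.
- exact: strongly_convex_tilt.
by move=> /(xgetI 0).
Qed.

End Minimizers.

(** * Change of the Bregman distance under one dual step *)

Section BregmanDescent.
Context {R : realType} {n : nat}.
Variables (nu : R) (f : 'cV[R]_n -> \bar R).
Hypotheses (nu_gt0 : 0 < nu) (f_proper : proper_functional f).
Hypotheses (f_lsc : lower_semicontinuous f) (f_convex : strongly_convex nu f).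

Lemma Pmin_edom zeta : edom f (Pmin f zeta).
Proof.
rewrite -(edom_tilt f zeta).
apply: argmin_edom; first exact: proper_functional_tilt.
exact: PminP f_convex.
Qed.

(** This is [D^zeta(w, P(zeta)) >= nu ||w - P(zeta)||^2]: quadratic growth of the tilted functional
    at its minimizer. *)
Lemma Pmin_growth zeta w : edom f w ->
  nu * edot (w - Pmin f zeta) (w - Pmin f zeta) <=
  fine (f w) - fine (f (Pmin f zeta)) - edot zeta (w - Pmin f zeta).
Proof.
move=> fw; have [fNy _] := f_proper.
have /= := strongly_convex_growth (w := w) nu_gt0
  (proper_functional_tilt zeta f_proper)
  (strongly_convex_tilt (zeta := zeta) f_proper f_convex)
  (PminP zeta nu_gt0 f_lsc f_proper f_convex).
rewrite edom_tilt => /(_ fw).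
rewrite (edom_fin_num fNy fw) (edom_fin_num fNy (Pmin_edom zeta)) /=.
by rewrite (edotBr zeta); lra.
Qed.

Lemma bregman_step zeta g t uhat : edom f uhat ->
  (bregman f (zeta - t *: g) uhat (Pmin f (zeta - t *: g))
     - bregman f zeta uhat (Pmin f zeta)
   <= (t * edot g (uhat - Pmin f zeta) + t ^+ 2 * edot g g / (4 * nu))%:E)%E.
Proof.
move=> fuhat; have [fNy _] := f_proper; set zeta' := zeta - _.
have growth := Pmin_growth zeta (Pmin_edom zeta').
(* The weight [nu] makes the quadratic term cancel against [growth]. *)
have young := edot_le_young (Pmin f zeta' - Pmin f zeta) (- t *: g) nu_gt0.
move: growth young; rewrite /bregman.
rewrite (edom_fin_num fNy fuhat) (edom_fin_num fNy (Pmin_edom zeta)).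
rewrite (edom_fin_num fNy (Pmin_edom zeta')) -!EFinB lee_fin /=.
set u := Pmin f zeta; set u' := Pmin f zeta'.
rewrite {1}/zeta' !edotZr !edotZl (edotC (u' - u) g) !edotBl !edotZl !edotBr.
have -> : - t * (- t * edot g g) / (4 * nu) = t ^+ 2 * edot g g / (4 * nu).
  by congr (_ / _); ring.
lra.
Qed.

End BregmanDescent.

(** * Arnoldi projection and the preconditioner [A^{-1/2}] *)

Section ArnoldiResidual.
Context {R : realType} {n l : nat}.

Lemma arnoldi_approxK (V : 'M[R]_(n, l.+1)) (H : 'M[R]_(l.+1, l)) :
  V^T *m V = 1%:M -> V^T *m arnoldi_approx V H = H *m (first_cols V)^T.
Proof. by move=> VV; rewrite /arnoldi_approx !mulmxA VV mul1mx. Qed.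

(** [<x, A x> = gam ||x||^2 + ||H^T x||^2]. *)
Lemma shifted_gram_spd m (gam : R) (H : 'M[R]_(l, m)) : 0 < gam ->
  spd (gam%:M + H *m H^T).
Proof.
move=> gam0; split=> [|x x0]; first by rewrite linearD /= tr_scalar_mx trmx_mul trmxK.
rewrite mulmxDl edotDr mul_scalar_mx edotZr -mulmxA (edotC x) edot_mulmxl.
by rewrite ltr_wpDr ?edot_ge0// mulr_gt0// edot_gt0.
Qed.

(* If no inverse square root existed, [invsqrtmx] would be its junk value [0] and
   the bound would hold trivially, so no spectral theorem is needed. *)
Lemma invsqrtmx_shifted_gram_contract m (gam : R) (H : 'M[R]_(l, m)) x :
  0 < gam ->
  gam * edot (invsqrtmx (gam%:M + H *m H^T) *m x)
             (invsqrtmx (gam%:M + H *m H^T) *m x) <= edot x x.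
Proof.
move=> gam0; have spdA := shifted_gram_spd H gam0.
rewrite /invsqrtmx; case: xgetP => [B _ [[Bt _] BB]|_]; last first.
  by rewrite mul0mx edot0l mulr0 edot_ge0.
rewrite edot_mulmxl Bt mulmxA BB.
set A := _ + _ in spdA BB *; set z := invmx A *m x.
have xE : x = A *m z by rewrite mulmxA mulmxV ?mul1mx// spd_unitmx.
have zA : gam * edot z z <= edot z x.
  rewrite xE mulmxDl edotDr mul_scalar_mx edotZr -mulmxA lerDl.
  by rewrite (edotC z) edot_mulmxl edot_ge0.
have := ler_wpM2l (ltW gam0) zA.
(* Expanding the square and using [gam^2 ||z||^2 <= gam <z, x>] leaves [gam <z, x> <= ||x||^2]. *)
have := edot_ge0 (x - gam *: z); rewrite edotBl !edotBr !edotZl !edotZr.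
rewrite (edotC z x); lra.
Qed.

End ArnoldiResidual.

(** * Descent of inner and outer updates *)

Section RiatDescent.
Context {R : realType} {n l q : nat}.
Variables (D : riat_input R n l q) (v : 'I_q -> 'cV[R]_n) (nu : R).
Hypotheses (V_orth : forall i, (rV D i)^T *m rV D i = 1%:M).
Hypotheses (noise : forall i, enorm (rv D i - v i) <= rdelta D i).
Hypotheses (tau_gt1 : 1 < rtau D).
Hypotheses (mu0_gt0 : 0 < rmu0 D) (mu1_gt0 : 0 < rmu1 D).

Lemma Ainvsqrt_sym gam i : (Ainvsqrt D gam i)^T = Ainvsqrt D gam i.
Proof.
by rewrite /Ainvsqrt /invsqrtmx; case: xgetP => [B _ [[]]|]; rewrite ?trmx0.
Qed.

(* <g, uhat - u> = - ||h||^2 - <h, w> with w = A^{-1/2} V^* (v^delta - v), and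
   ||w|| <= delta / sqrt gamma < ||h|| / tau. *)
Lemma gvec_descent gam i u uhat : 0 < gam ->
  arnoldi_approx (rV D i) (rH D i) *m uhat = v i -> active D gam i u ->
  edot (gvec D gam i u) (uhat - u) <=
  - (1 - 1 / rtau D) * enorm (hvec D gam i u) ^+ 2.
Proof.
move=> gam0 uhatE; rewrite /active !sqr_enorm => act.
set h := hvec D gam i u in act *; set e := rv D i - v i.
set w := Ainvsqrt D gam i *m ((rV D i)^T *m e).
have -> : edot (gvec D gam i u) (uhat - u) = - edot h h - edot h w.
  rewrite /gvec -/h edot_mulmxl !trmx_mul Ainvsqrt_sym trmxK.
  rewrite -edotNr -edotBr; congr edot.
  rewrite -arnoldi_approxK// /h /hvec /w /e.
  move: (arnoldi_approx _ _) uhatE => M uhatE.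
  rewrite -!mulmxA -mulmxN -mulmxBr -mulmxN -mulmxBr (mulmxBr M) uhatE.
  by congr (_ *m (_ *m _)); rewrite !opprB [RHS]addrC addrA subrK.
(* Contraction, Bessel, noise bound and discrepancy test chain to [gam tau^2 ||w||^2 <= tau^2
   delta^2 < gam ||h||^2]. *)
have wle : rtau D ^+ 2 * edot w w <= edot h h.
  have e2 : edot e e <= rdelta D i ^+ 2.
    by rewrite -sqr_enorm lerXn2r ?nnegrE ?enorm_ge0 ?noise ?(le_trans _ (noise i)) ?enorm_ge0.
  have := invsqrtmx_shifted_gram_contract (rH D i) ((rV D i)^T *m e) gam0.
  rewrite -/(Ainvsqrt D gam i) -/w => gw.
  have := bessel e (V_orth i) => ve.
  rewrite -(ler_pM2l gam0) ltW// (le_lt_trans _ act)//.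
  rewrite mulrCA ler_wpM2l ?sqr_ge0//.
  exact: le_trans gw (le_trans ve e2).
(* Together with [wle] this square gives [- 2 tau <h, w> <= 2 ||h||^2]. *)
have := edot_ge0 (h + rtau D *: w).
rewrite edotDl !edotDr !edotZl !edotZr (edotC w h) => sq.
have t0 : 0 < rtau D := lt_trans ltr01 tau_gt1.
have hw : - edot h w <= edot h h / rtau D by rewrite ler_pdivlMr// ; nra.
lra.
Qed.

Lemma step_size_ge0 phi g : 0 <= phi -> 0 <= step_size D phi g.
Proof.
move=> phi0; rewrite /step_size; case: ifP => _; first exact: ltW.
by rewrite le_min (ltW mu1_gt0) andbT divr_ge0 ?sqr_ge0// mulr_ge0// ltW.
Qed.

Lemma step_size_sqr phi g : 0 <= phi ->
  step_size D phi g * edot g g <= rmu0 D * phi.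
Proof.
move=> phi0; rewrite /step_size; case: eqVneq => [->|g0].
  by rewrite edot0l mulr0 mulr_ge0// ltW.
by rewrite -sqr_enorm -ler_pdivlMr ?ge_min ?lexx// sqr_enorm edot_gt0.
Qed.

Hypotheses (nu_gt0 : 0 < nu) (f_proper : proper_functional (rf D)).
Hypotheses (f_lsc : lower_semicontinuous (rf D)).
Hypotheses (f_convex : strongly_convex nu (rf D)).
Variable uhat : 'cV[R]_n.
Hypothesis uhat_sol : solution_set (rf D) (rV D) (rH D) v uhat.

Let C0 := 1 - 1 / rtau D - rmu0 D / (4 * nu).
Let P := Pmin (rf D).
Let Gamma zeta := bregman (rf D) zeta uhat (P zeta).

Lemma step_descent zeta g phi : 0 <= phi ->
  edot g (uhat - P zeta) <= - (1 - 1 / rtau D) * phi ->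
  (Gamma (zeta - step_size D phi g *: g) - Gamma zeta
   <= (- C0 * step_size D phi g * phi)%:E)%E.
Proof.
move=> phi0 gdesc; set t := step_size D phi g.
apply: le_trans (bregman_step nu_gt0 f_proper f_lsc f_convex _ _ _ uhat_sol.1) _.
rewrite lee_fin.
have t0 : 0 <= t by exact: step_size_ge0.
have p4 : 0 <= (4 * nu)^-1 by rewrite invr_ge0 mulr_ge0// ltW.
have h1 := ler_wpM2l t0 gdesc.
have h2 := ler_wpM2r p4 (ler_wpM2l t0 (step_size_sqr g phi0)).
have -> : - C0 * t * phi =
    t * (- (1 - 1 / rtau D) * phi) + t * (rmu0 D * phi) / (4 * nu).
  by rewrite /C0; ring.
by rewrite lerD// expr2 -(mulrA t t).
Qed.

(** Covers inactive updates, whose step size is [0]; finiteness of the distance makes the difference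
    a real [0]. *)
Lemma null_step zeta : (Gamma (zeta - 0) - Gamma zeta <= 0)%E.
Proof.
have [fNy _] := f_proper; rewrite subr0 /Gamma /bregman.
rewrite (edom_fin_num fNy uhat_sol.1).
rewrite (edom_fin_num fNy (Pmin_edom nu_gt0 f_proper f_lsc f_convex zeta)).
by rewrite -!EFinB lee_fin subrr.
Qed.

Lemma inner_descent gam i zeta : 0 < gam ->
  (Gamma (zeta - inner_step_size D gam i (P zeta) *: gvec D gam i (P zeta))
     - Gamma zeta
   <= (- C0 * inner_step_size D gam i (P zeta)
         * enorm (hvec D gam i (P zeta)) ^+ 2)%:E)%E.
Proof.
move=> gam0; rewrite /inner_step_size; case: ifPn => [act|_].
  apply: step_descent; first exact: sqr_ge0.
  exact: gvec_descent (uhat_sol.2 i) act.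
by rewrite scale0r mulr0 mul0r null_step.
Qed.

Lemma outer_descent gam zeta : 0 < gam ->
  (Gamma (zeta - outer_step_size D gam (P zeta) *: outer_g D gam (P zeta))
     - Gamma zeta
   <= (- C0 * outer_step_size D gam (P zeta) * outer_Phi D gam (P zeta))%:E)%E.
Proof.
move=> gam0; rewrite /outer_step_size; case: ifPn => [_|_].
  apply: step_descent; first by apply: sumr_ge0 => i _; exact: sqr_ge0.
  (* The descent bound is summed over the active equations. *)
  rewrite /outer_g edot_suml /outer_Phi mulr_sumr; apply: ler_sum => i.
  by rewrite inE => act; exact: gvec_descent (uhat_sol.2 i) act.
by rewrite scale0r mulr0 mul0r null_step.
Qed.

End RiatDescent.

Theorem lemma5p1 (R : realType) (n l q : nat) (hl : (1 <= l)%N) (hln : (l < n)%N)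
  (f : 'cV[R]_n -> \bar R) (nu : R)
  (f_proper : proper_functional f) (f_lsc : lower_semicontinuous f)
  (nu_gt0 : 0 < nu) (f_convex : strongly_convex nu f)
  (T : 'I_q -> 'M[R]_n)
  (V : 'I_q -> 'M[R]_(n, l.+1)) (H : 'I_q -> 'M[R]_(l.+1, l))
  (arnoldi : forall i, arnoldi_decomposition (T i) (V i) (H i))
  (v vdelta : 'I_q -> 'cV[R]_n) (delta : 'I_q -> R)
  (noise : forall i, enorm (vdelta i - v i) <= delta i)
  (gamma : nat -> R) (gamma_gt0 : forall j, 0 < gamma j)
  (gamma_decr : forall j, gamma j.+1 <= gamma j)
  (gamma_div : series (fun j => (gamma j)^-1) @ \oo --> +oo)
  (len : nat -> nat) (len_gt0 : forall k, (0 < len k)%N)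
  (tau mu0 mu1 : R) (tau_gt1 : 1 < tau) (mu0_gt0 : 0 < mu0) (mu1_gt0 : 0 < mu1)
  (C0 : R) (C0_def : C0 = 1 - 1 / tau - mu0 / (4 * nu)) (C0_gt0 : 0 < C0)
  (zeta0 : 'cV[R]_n)
  (d : measure_display) (Omega : measurableType d) (Pr : probability Omega R)
  (idx : nat * nat -> Omega -> 'I_q)
  (idx_iid : iid_uniform Pr [set km | (km.2 < len km.1)%N] idx)
  (uhat : 'cV[R]_n) (uhat_sol : solution_set f V H v uhat) (omega : Omega) :
  let D := RiatInput f V H vdelta delta gamma len tau mu0 mu1 zeta0 in
  let i := fun k m => idx (k, m) omega in
  forall k : nat, upto_stop D i k ->
  (forall m : nat, (m < len k)%N ->
     (Gamma_in D i uhat k m.+1 - Gamma_in D i uhat k m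
      <= (- C0 * t_in D i k m * enorm (h_in D i k m) ^+ 2)%:E)%E)
  /\ (Gamma_in D i uhat k.+1 0 - Gamma_out D i uhat k.+1
      <= (- C0 * t_out D i k.+1 * Phi_out D i k.+1)%:E)%E.
Proof.
move=> D i k _.
have V_orth j : (rV D j)^T *m rV D j = 1%:M by have [] := arnoldi j.
split=> [m _|].
  (* [zeta_in k m.+1] unfolds to one inner update of [zeta_in k m]. *)
  rewrite C0_def; apply: (@inner_descent _ _ _ _ D v nu V_orth noise) => //.
  exact: gamma_gt0.
(* [zeta_in k.+1 0] unfolds to the outer update of [zeta_out k.+1]. *)
rewrite C0_def; apply: (@outer_descent _ _ _ _ D v nu V_orth noise) => //.
exact: gamma_gt0.
Qed.
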